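(* Let $(\mathbf X,\mathbf Y)$ be a general correlated source which is uniformly integrable. Then $R_{SW}(\mathbf X|\mathbf Y)=\overline H_s(\mathbf X|\mathbf Y)$.
   Context: A general correlated source $(\mathbf X,\mathbf Y)=\{(X^n,Y^n)\}_{n\ge1}$ is an arbitrary sequence of pairs of random variables, $(X^n,Y^n)$ on $\mathcal X^n\times\mathcal Y^n$ with $\mathcal X,\mathcal Y$ finite or countably infinite, joint distribution $P_{X^nY^n}$ (no structural assumptions; all marginal probabilities positive). Logs base 2. Uniform integrability: a sequence $\{Z_n\}$ of discrete real random variables is uniformly integrable if $\lim_{u\to\infty}\sup_{n}\sum_{z:|z|\ge u}P_{Z_n}(z)|z|=0$; the source is called uniformly integrable if $\{\frac1n\log\frac1{P_{X^n|Y^n}(X^n|Y^n)}\}_n$ is. For $x^n\in\mathcal X^n$ and $\varepsilon\in(0,1]$, $\overline h^\varepsilon(x^n)=\inf\{a\in\mathbb R:\sum_{y^n:\log(1/P_{X^n|Y^n}(x^n|y^n))>a}P_{Y^n|X^n}(y^n|x^n)\le\varepsilon\}$; $\overline H_s^\varepsilon(X^n|Y^n)=\sum_{x^n}P_{X^n}(x^n)\overline h^\varepsilon(x^n)$; $\overline H_s(\mathbf X|\mathbf Y)=\lim_{\varepsilon\downarrow0}\limsup_n\frac1n\overline H_s^\varepsilon(X^n|Y^n)$. Slepian–Wolf (SW) code of blocklength $n$: $(\varphi_n,\psi_n)$ with encoder $\varphi_n:\mathcal X^n\to\{0,1\}^*$ whose set of codewords is prefix-free and decoder $\psi_n:\{0,1\}^*\times\mathcal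 Y^n\to\mathcal X^n$; error probability $\Pr\{\psi_n(\varphi_n(X^n),Y^n)\ne X^n\}$; $\ell_n(x^n)$ the length of $\varphi_n(x^n)$. A rate $R$ is weakly lossless achievable if there are SW codes with error probability $\to0$ and $\limsup_n\frac1n\mathbb E[\ell_n(X^n)]\le R$; $R_{SW}(\mathbf X|\mathbf Y)$ is the infimum of such rates. *)

(* Defs.v *)
From HB Require Import structures.
From mathcomp Require Import all_boot all_order all_algebra.
From mathcomp Require Import all_classical all_reals all_analysis.
Set Implicit Arguments. Unset Strict Implicit. Unset Printing Implicit Defensive.
Import Order.TTheory GRing.Theory Num.Theory.
Import numFieldNormedType.Exports.
Local Open Scope classical_set_scope.
Local Open Scope ring_scope.

Section SW.
Variables (R : realType) (X Y : countType).

(* A general correlated source: P n x y = P_{X^n Y^n}(x, y). *)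
Definition source := forall n : nat, n.-tuple X -> n.-tuple Y -> R.

Definition log2 (x : R) : R := ln x / ln 2.

Variable P : source.

Definition PX n (x : n.-tuple X) : R := fine (\esum_(y in setT) (P x y)%:E).
Definition PY n (y : n.-tuple Y) : R := fine (\esum_(x in setT) (P x y)%:E).
Definition PXgY n (x : n.-tuple X) (y : n.-tuple Y) : R := P x y / PY y.
Definition PYgX n (y : n.-tuple Y) (x : n.-tuple X) : R := P x y / PX x.

Definition is_source : Prop :=
  forall n, (0 < n)%N ->
    [/\ (forall (x : n.-tuple X) (y : n.-tuple Y), 0 <= P x y),
        \esum_(xy in [set: n.-tuple X * n.-tuple Y]) (P xy.1 xy.2)%:E = 1%E,
        (forall x : n.-tuple X, 0 < PX x) &
        (forall y : n.-tuple Y, 0 < PY y)].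

Definition Zn n (x : n.-tuple X) (y : n.-tuple Y) : R :=
  n%:R^-1 * log2 (PXgY x y)^-1.

Definition PZ n (z : R) : R :=
  fine (\esum_(xy in [set xy : n.-tuple X * n.-tuple Y | Zn xy.1 xy.2 = z])
          (P xy.1 xy.2)%:E).

(* sum_{z : |z| >= u} P_{Z_n}(z) |z|  (over the countable support of P_{Z_n}) *)
Definition UI_tail n (u : R) : \bar R :=
  \esum_(z in [set z : R | u <= `|z|]) (PZ n z * `|z|)%:E.

Definition uniformly_integrable : Prop :=
  (ereal_sup [set UI_tail n u | n in [set n | (0 < n)%N]])
    @[u --> +oo] --> 0%E.

Definition hbar n (eps : R) (x : n.-tuple X) : \bar R :=
  ereal_inf [set a%:E | a in [set a : R |
     (\esum_(y in [set y | (a < log2 (PXgY x y)^-1)%R]) (PYgX y x)%:E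
        <= eps%:E)%E]].

Definition Hs_eps n (eps : R) : \bar R :=
  \esum_(x in [set: n.-tuple X]) ((PX x)%:E * hbar eps x)%E.

Definition Hs_bar : \bar R :=
  lim ((limn_esup (fun n => (n%:R^-1)%:E * Hs_eps n eps)%E) @[eps --> 0^'+]).

Definition prefix_free n (enc : n.-tuple X -> seq bool) : Prop :=
  forall x x', prefix (enc x) (enc x') -> enc x = enc x'.

Definition err_prob n (enc : n.-tuple X -> seq bool)
    (dec : seq bool -> n.-tuple Y -> n.-tuple X) : \bar R :=
  \esum_(xy in [set xy : n.-tuple X * n.-tuple Y | dec (enc xy.1) xy.2 != xy.1])
     (P xy.1 xy.2)%:E.

Definition exp_len n (enc : n.-tuple X -> seq bool) : \bar R :=
  \esum_(x in [set: n.-tuple X]) (PX x * (size (enc x))%:R)%:E.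

Definition weakly_achievable (r : R) : Prop :=
  exists (enc : forall n, n.-tuple X -> seq bool)
         (dec : forall n, seq bool -> n.-tuple Y -> n.-tuple X),
    [/\ (forall n, (0 < n)%N -> prefix_free (enc n)),
        err_prob (enc n) (dec n) @[n --> \oo] --> 0%E &
        (limn_esup (fun n => (n%:R^-1)%:E * exp_len (enc n))%E <= r%:E)%E].

Definition R_SW : \bar R := ereal_inf [set r%:E | r in weakly_achievable].

End SW.

(* Main.v *)
Require Import Defs.
From HB Require Import structures.
From mathcomp Require Import all_boot all_order all_algebra.
From mathcomp Require Import all_classical all_reals all_analysis.
From mathcomp Require Import lra ring.
(** Converse: for a prefix-free code, outside the error event x ranges for each
    y over a set on which the encoder is injective, so by Kraft's inequality
    log 1/P(x|y) > len(x) + nd has probability at most err + 2^(-nd).  By Markov's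
    inequality the eps-quantile of log 1/P(x|Y) given x exceeds len(x) + nd by at
    most eps^-1 times the conditional expectation of log 1/P on that event, and
    uniform integrability makes the average of these excesses o(n).

    Achievability: with j(x) proportional to the eps-quantile, encode x as j(x) in
    unary followed by a bin label of K j(x) bits.  Labels are chosen greedily along
    an enumeration of X^n: averaging over all labels bounds the probability that an
    earlier x' with the same codeword is typical with y.  Given y, the decoder
    returns the first typical x' with the received codeword.  Finally eps tends to
    0 along with n. *)

Set Implicit Arguments. Unset Strict Implicit. Unset Printing Implicit Defensive.
Import Order.TTheory GRing.Theory Num.Theory.
Import numFieldNormedType.Exports.
Local Open Scope classical_set_scope.
Local Open Scope ring_scope.

(** * Sums of nonnegative extended reals over arbitrary index types *)

Section Sums.
Local Open Scope ereal_scope.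
Context {R : realType}.

Lemma le_esumT (T : choiceType) (f g : T -> \bar R) :
  (forall x, f x <= g x) -> \esum_(x in setT) f x <= \esum_(x in setT) g x.
Proof. by move=> fg; exact: le_esum. Qed.

(** Finite partial sums give one inequality, [H]; for positive [c], applying it to [c^-1] and
    [c * f] gives the other. *)
Lemma esumZl (T : choiceType) (D : set T) (c : R) (f : T -> \bar R) : (0 <= c)%R ->
  (forall x, 0 <= f x) ->
  \esum_(x in D) (c%:E * f x) = c%:E * \esum_(x in D) f x.
Proof.
move=> c0 f0.
have H (d : R) (g : T -> \bar R) : (0 <= d)%R -> (forall x, 0 <= g x) ->
    \esum_(x in D) (d%:E * g x) <= d%:E * \esum_(x in D) g x.
  move=> d0 g0; apply: ge_ereal_sup => _ [A [finA AD] <-].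
  rewrite -ge0_mule_fsumr//; apply: lee_wpmul2l; first by rewrite lee_fin.
  by apply: ereal_sup_ubound; exists A.
apply/eqP; rewrite eq_le H//=.
have [->|cN0] := eqVneq c 0%R.
  by rewrite mul0e; apply: esum_ge0 => x _; rewrite mul0e.
have cp : (0 < c)%R by rewrite lt_neqAle eq_sym cN0.
rewrite muleC -lee_pdivlMr// muleC.
apply: le_trans (H _ _ _ _); rewrite ?invr_ge0//; last first.
  by move=> x; rewrite mule_ge0// lee_fin.
by apply: le_esum => x _; rewrite muleA -EFinM mulVf// mul1e.
Qed.

Lemma esum_pair (S T : choiceType) (f : S -> T -> \bar R) :
  (forall x y, 0 <= f x y) ->
  \esum_(z in [set: S * T]) f z.1 z.2 =
  \esum_(x in [set: S]) \esum_(y in [set: T]) f x y.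
Proof.
by move=> f0; rewrite esum_esum//; congr (esum _ _); apply/seteqP; split.
Qed.

Lemma esum_swap (S T : choiceType) (f : S -> T -> \bar R) :
  (forall x y, 0 <= f x y) ->
  \esum_(x in [set: S]) \esum_(y in [set: T]) f x y =
  \esum_(y in [set: T]) \esum_(x in [set: S]) f x y.
Proof.
move=> f0; rewrite -!esum_pair//.
rewrite (reindex_esum [set: T * S] [set: S * T] (fun z => (z.2, z.1)))//.
by split=> //= [[a b] [c d] _ _ [-> ->]//|[a b] _]; exists (b, a).
Qed.

Lemma esum_mono (T : choiceType) (D E : set T) (f : T -> \bar R) :
  (forall x, 0 <= f x) -> D `<=` E -> \esum_(x in D) f x <= \esum_(x in E) f x.
Proof.
move=> f0 DE; rewrite esum_mkcond [leRHS]esum_mkcond; apply: le_esumT => x.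
case: ifPn => [|_]; last by case: ifP.
by rewrite inE => /DE Ex; rewrite mem_set.
Qed.

Lemma le_term_esum (T : choiceType) (f : T -> \bar R) x :
  (forall x, 0 <= f x) -> f x <= \esum_(x in setT) f x.
Proof. by move=> f0; rewrite -(@esum_set1 _ _ x f)//; exact: esum_mono. Qed.

Lemma esum_unique (T : choiceType) (D : set T) (c : \bar R) : 0 <= c ->
  (forall x y, D x -> D y -> x = y) -> \esum_(x in D) c <= c.
Proof.
move=> c0 Du; have [->|/set0P[x Dx]] := eqVneq D set0; first by rewrite esum_set0.
rewrite (_ : D = [set x]) ?esum_set1//.
by apply/seteqP; split=> [y Dy|y ->//]; exact: Du.
Qed.

End Sums.

(** * Kraft's inequality *)

Section Kraft.
Context {R : realType}.

(** Induction on a strict bound for the word lengths. If the empty word occurs, prefix-freeness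
    makes it the only word. Otherwise the words split by first bit, and each class, with that bit
    removed, contributes at most one half. *)
Lemma kraft_seq (s : seq (seq bool)) : uniq s ->
  {in s &, forall u v, prefix u v -> u = v} ->
  \sum_(u <- s) (2^-1 : R) ^+ size u <= 1.
Proof.
have [n sn] : exists n, {in s, forall u, size u < n}%N.
  exists (\max_(u <- s) size u).+1 => u us; rewrite ltnS.
  exact: leq_bigmax_seq.
elim: n s sn => [|n IH] s sn us ps.
  by case: s sn {us ps} => [|u s sn]; [rewrite big_nil|have := sn u (mem_head _ _)].
have [sh|nils] := boolP ([::] \in s).
  have H u : u \in s -> u = [::] by move=> us'; rewrite -(ps [::] u sh us' (prefix0s _)).
  case: s us {ps sn IH sh} H => [|u [|v s]]//=; first by rewrite big_nil.
    by move=> _ H; rewrite big_seq1 (H u) ?expr0// mem_head.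
  move=> /andP[+ _] H; have -> := H u (mem_head _ _).
  by have -> : v = [::]; [apply: H; rewrite !inE eqxx orbT|rewrite mem_head].
(* The default [b] lets the empty word satisfy [hd b] for both bits; this is harmless because [[::]]
   is not in [s] here. *)
pose hd (b : bool) (u : seq bool) := head b u == b.
pose t b := [seq behead u | u <- s & hd b u].
have st b u : u \in s -> hd b u -> u = b :: behead u.
  by move=> us' /eqP; case: u us' => [/(negP nils)//|a u _ /= ->].
have t1 b : \sum_(u <- t b) (2^-1 : R) ^+ size u <= 1.
  have mt u : u \in t b -> (b :: u) \in s.
    case/mapP => v; rewrite mem_filter => /andP[hv vs] ->.
    by rewrite -(st _ _ vs hv).
  apply: IH.
  - by move=> u /mt /sn.
  - rewrite map_inj_in_uniq ?filter_uniq// => u v; rewrite !mem_filter.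
    by move=> /andP[hu us'] /andP[hv vs] e; rewrite (st _ _ us' hu) (st _ _ vs hv) e.
  - move=> u v /mt us' /mt vs uv.
    by have := ps _ _ us' vs; rewrite prefix_cons eqxx => /(_ uv)[].
have -> : \sum_(u <- s) (2^-1 : R) ^+ size u =
    2^-1 * \sum_(u <- t true) (2^-1 : R) ^+ size u +
    2^-1 * \sum_(u <- t false) (2^-1 : R) ^+ size u.
  rewrite !big_map !big_filter !mulr_sumr (bigID (hd true)) /=.
  have E b : \sum_(u <- s | hd b u) (2^-1 : R) ^+ size u =
      \sum_(u <- s | hd b u) 2^-1 * 2^-1 ^+ size (behead u).
    rewrite big_seq_cond [RHS]big_seq_cond; apply: eq_bigr => u /andP[us' hu].
    by rewrite {1}(st _ _ us' hu) /= exprS.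
  congr (_ + _); first exact: E.
  rewrite -E big_seq_cond [RHS]big_seq_cond; apply: eq_bigl => u.
  by case us': (u \in s) => //=; case: u us' => [/(negP nils)//|[] u].
have := t1 true; have := t1 false.
set x := \sum_(_ <- _) _; set y := \sum_(_ <- _) _ => hx hy; lra.
Qed.

Lemma kraft (T : choiceType) (D : set T) (enc : T -> seq bool) :
  (forall x y, D x -> D y -> prefix (enc x) (enc y) -> x = y) ->
  (\esum_(x in D) ((2^-1 : R) ^+ size (enc x))%:E <= 1)%E.
Proof.
move=> encP; apply: ge_ereal_sup => _ [A [finA AD] <-].
rewrite fsbig_finite//= sumEFin lee_fin.
have inD x : x \in finmap.enum_fset (fset_set A) -> D x.
  by move=> xA; apply: AD; rewrite -(fset_setK finA).
rewrite -(big_map enc xpredT (fun u => 2^-1 ^+ size u)); apply: kraft_seq.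
  rewrite map_inj_in_uniq ?fset_uniq// => x y /inD Dx /inD Dy exy.
  by apply: encP => //; rewrite exy prefix_refl.
by move=> u v /mapP[x /inD Dx ->] /mapP[y /inD Dy ->] /(encP _ _ Dx Dy) ->.
Qed.

End Kraft.

(** * Real powers of two *)

Section Pow2.
Context {R : realType}.

Definition pow2 (a : R) : R := expR (a * ln 2).

Lemma ln2_gt0 : 0 < ln 2 :> R.
Proof. by rewrite ln_gt0// ltr1n. Qed.

Lemma pow2_ge0 a : 0 <= pow2 a.
Proof. exact: expR_ge0. Qed.

Lemma pow2D a b : pow2 (a + b) = pow2 a * pow2 b.
Proof. by rewrite /pow2 mulrDl expRD. Qed.

Lemma pow2N a : pow2 (- a) = (pow2 a)^-1.
Proof. by rewrite /pow2 mulNr expRN. Qed.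

Lemma pow2_nat (n : nat) : pow2 n%:R = 2 ^+ n.
Proof. by rewrite /pow2 expRM_natl lnK// posrE. Qed.

Lemma pow2N_nat (n : nat) : pow2 (- n%:R) = 2^-1 ^+ n.
Proof. by rewrite pow2N pow2_nat exprVn. Qed.

Lemma ler_pow2 a b : (pow2 a <= pow2 b) = (a <= b).
Proof. by rewrite ler_expR ler_pM2r// ln2_gt0. Qed.

Lemma pow2_log2 q : 0 < q -> pow2 (log2 q) = q.
Proof. by move=> q0; rewrite /pow2 /log2 divfK ?gt_eqF ?ln2_gt0// lnK. Qed.

End Pow2.

(** * A single joint distribution: marginals, conditionals, information and its quantile *)

Section Joint.
Context {R : realType} {A B : countType} (p : A -> B -> R).
Hypothesis p_ge0 : forall x y, 0 <= p x y.
Hypothesis p_sum1 : (\esum_(z in [set: A * B]) (p z.1 z.2)%:E = 1)%E.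

Definition margX x : R := fine (\esum_(y in [set: B]) (p x y)%:E).
Definition margY y : R := fine (\esum_(x in [set: A]) (p x y)%:E).
Definition condX x y : R := p x y / margY y.
Definition condY y x : R := p x y / margX x.
(** Where [condX x y = 0] the value is 0 rather than infinite, since inverse and logarithm send 0 to
    0. *)
Definition info x y : R := log2 (condX x y)^-1.
Definition quantile (eps : R) x : \bar R :=
  ereal_inf [set a%:E | a in [set a : R |
     (\esum_(y in [set y | (a < info x y)%R]) (condY y x)%:E <= eps%:E)%E]].

Lemma sum_xy : (\esum_(x in [set: A]) \esum_(y in [set: B]) (p x y)%:E = 1)%E.
Proof. by rewrite -esum_pair// => x y; rewrite lee_fin. Qed.

Lemma sum_yx : (\esum_(y in [set: B]) \esum_(x in [set: A]) (p x y)%:E = 1)%E.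
Proof. by rewrite esum_swap ?sum_xy// => x y; rewrite lee_fin. Qed.

Lemma margXE x : (margX x)%:E = (\esum_(y in [set: B]) (p x y)%:E)%E.
Proof.
rewrite /margX fineK// ge0_fin_numE ?esum_ge0// => [|y _]; last by rewrite lee_fin.
apply: le_lt_trans (ltry 1); rewrite -sum_xy.
apply: (le_term_esum (f := fun x => \esum_(y in [set: B]) (p x y)%:E)%E).
by move=> z; apply: esum_ge0 => y _; rewrite lee_fin.
Qed.

Lemma margYE y : (margY y)%:E = (\esum_(x in [set: A]) (p x y)%:E)%E.
Proof.
rewrite /margY fineK// ge0_fin_numE ?esum_ge0// => [|x _]; last by rewrite lee_fin.
apply: le_lt_trans (ltry 1); rewrite -sum_yx.
apply: (le_term_esum (f := fun y => \esum_(x in [set: A]) (p x y)%:E)%E).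
by move=> z; apply: esum_ge0 => x _; rewrite lee_fin.
Qed.

Lemma sum_margX : (\esum_(x in [set: A]) (margX x)%:E = 1)%E.
Proof. by under eq_esum do rewrite margXE; exact: sum_xy. Qed.

Lemma sum_margY : (\esum_(y in [set: B]) (margY y)%:E = 1)%E.
Proof. by under eq_esum do rewrite margYE; exact: sum_yx. Qed.

Hypothesis margX_gt0 : forall x, 0 < margX x.
Hypothesis margY_gt0 : forall y, 0 < margY y.

Lemma joint_condX x y : p x y = margY y * condX x y.
Proof. by rewrite mulrC divfK// gt_eqF. Qed.

Lemma joint_condY x y : p x y = margX x * condY y x.
Proof. by rewrite mulrC divfK// gt_eqF. Qed.

Lemma condX_ge0 x y : 0 <= condX x y.
Proof. by rewrite divr_ge0// ltW. Qed.

Lemma condY_ge0 y x : 0 <= condY y x.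
Proof. by rewrite divr_ge0// ltW. Qed.

Lemma sum_condX y : (\esum_(x in [set: A]) (condX x y)%:E = 1)%E.
Proof.
under eq_esum do rewrite /condX mulrC EFinM.
rewrite esumZl ?invr_ge0 ?ltW// => [|x]; last by rewrite lee_fin.
by rewrite -margYE -EFinM mulVf// gt_eqF.
Qed.

Lemma sum_condY x : (\esum_(y in [set: B]) (condY y x)%:E = 1)%E.
Proof.
under eq_esum do rewrite /condY mulrC EFinM.
rewrite esumZl ?invr_ge0 ?ltW// => [|y]; last by rewrite lee_fin.
by rewrite -margXE -EFinM mulVf// gt_eqF.
Qed.

Lemma condX_le1 x y : condX x y <= 1.
Proof.
rewrite -lee_fin -(sum_condX y).
by apply: (le_term_esum (f := fun x => (condX x y)%:E)) => z; rewrite lee_fin condX_ge0.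
Qed.

Lemma info_ge0 x y : 0 <= info x y.
Proof.
rewrite /info /log2 divr_ge0 ?(ltW ln2_gt0)//.
have [->|c0] := eqVneq (condX x y) 0; first by rewrite invr0 ln0.
by rewrite ln_ge0// invf_ge1 ?condX_le1// lt_neqAle eq_sym c0 condX_ge0.
Qed.

Lemma condX_info x y : 0 < condX x y -> condX x y = pow2 (- info x y).
Proof. by move=> c0; rewrite pow2N pow2_log2 ?invr_gt0// invrK. Qed.

Lemma condX_le x y b : 0 <= b -> b < info x y -> condX x y <= pow2 (- b).
Proof.
move=> b0 bi; have [c0|c0] := ltP 0 (condX x y).
  by rewrite condX_info// ler_pow2 lerN2 ltW.
exact: le_trans c0 (pow2_ge0 _).
Qed.

Lemma condX_ge x y b : 0 < p x y -> info x y <= b -> pow2 (- b) <= condX x y.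
Proof.
by move=> p0 ib; rewrite condX_info ?ler_pow2 ?lerN2// divr_gt0.
Qed.

End Joint.

Lemma esum_cond {R : realType} (T : choiceType) (b : T -> bool) (f : T -> \bar R) :
  (\esum_(x in [set x | b x]) f x = \esum_(x in [set: T]) if b x then f x else 0)%E.
Proof. by rewrite esum_mkcond; apply: eq_esum => x _; rewrite mem_setE. Qed.

(** * One-shot converse *)

Section Converse.
Context {R : realType} {A B : countType} (p : A -> B -> R).
Hypothesis p_ge0 : forall x y, 0 <= p x y.
Hypothesis p_sum1 : (\esum_(z in [set: A * B]) (p z.1 z.2)%:E = 1)%E.
Hypothesis margX_gt0 : forall x, 0 < margX p x.
Hypothesis margY_gt0 : forall y, 0 < margY p y.

Local Notation info := (info p).
Local Notation condY := (condY p).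
Local Notation margX := (margX p).
Local Notation quantile := (quantile p).

(** Markov's inequality at the level [a = b + eps^-1 * M], with [M] the sum on the right: as
    [a >= b], [a] times the conditional probability of [info > a] is at most [M], hence at most
    [a * eps]. Positivity of [b] allows division by [a]. *)
Lemma quantile_le x (b eps : R) : 0 < b -> 0 < eps ->
  (quantile eps x <= b%:E + (eps^-1)%:E *
     \esum_(y in [set: B]) if (b < info x y)%R then (condY y x * info x y)%:E else 0)%E.
Proof.
move=> b0 eps0; set M := (\esum_(y in _) _)%E.
have q0 y : 0 <= condY y x by exact: condY_ge0.
have i0 y : 0 <= info x y by exact: info_ge0.
have M0 : (0 <= M)%E.
  by apply: esum_ge0 => y _; case: ifP => // _; rewrite lee_fin mulr_ge0.
case EM: M M0 => [m| |] // m0; last first.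
  by rewrite mulry gtr0_sg ?invr_gt0// mul1e addey// leey.
rewrite lee_fin in m0.
have a_ge : b <= b + eps^-1 * m by rewrite lerDl mulr_ge0// invr_ge0 ltW.
apply: ereal_inf_lbound; exists (b + eps^-1 * m); last by rewrite EFinD EFinM.
rewrite /= esum_cond; set a := b + _ in a_ge *.
have a0 : 0 < a by exact: lt_le_trans a_ge.
rewrite -(@lee_pmul2l _ a%:E)// ?lte_fin//.
apply: (@le_trans _ _ m%:E); last first.
  rewrite -EFinM lee_fin mulrDl mulrAC mulVf ?gt_eqF// mul1r lerDr.
  by rewrite mulr_ge0// ltW.
rewrite -esumZl ?(ltW a0)//; last by move=> y; case: ifP => // _; rewrite lee_fin.
rewrite -EM; apply: le_esumT => y; case: ifPn => [ai|_].
  rewrite (le_lt_trans a_ge ai) -EFinM lee_fin mulrC.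
  by apply: ler_wpM2l => //; exact: ltW.
by rewrite mule0; case: ifP => // _; rewrite lee_fin mulr_ge0.
Qed.

Variables (enc : A -> seq bool) (dec : seq bool -> B -> A).
Hypothesis enc_prefix : forall x x', prefix (enc x) (enc x') -> enc x = enc x'.

Definition error : \bar R :=
  (\esum_(z in [set z : A * B | dec (enc z.1) z.2 != z.1]) (p z.1 z.2)%:E)%E.

Lemma errorE : error =
  (\esum_(x in [set: A]) \esum_(y in [set: B])
     if dec (enc x) y != x then (p x y)%:E else 0)%E.
Proof.
rewrite /error esum_cond.
rewrite (esum_pair (f := fun x y => if dec (enc x) y != x then (p x y)%:E else 0%E))//.
by move=> x y; case: ifP => // _; rewrite lee_fin.
Qed.

(* Outside the error event x lies in a set D_y on which enc is an injective
   prefix code; Kraft's inequality on D_y bounds the sum of condX x y. *)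
Lemma long_info_prob (t : R) : 0 <= t ->
  (\esum_(x in [set: A]) \esum_(y in [set: B])
     (if ((size (enc x))%:R + t < info x y)%R then (p x y)%:E else 0)
   <= error + (pow2 (- t))%:E)%E.
Proof.
move=> t0.
(* [good] dominates [p x y] whenever decoding succeeds and the information exceeds the length by
   more than [t]. *)
pose good x y := if dec (enc x) y == x
  then (margY p y * (pow2 (- t) * (2^-1 : R) ^+ size (enc x)))%:E else 0%E.
have good0 x y : (0 <= good x y)%E.
  rewrite /good; case: ifP => // _.
  by rewrite lee_fin !mulr_ge0// ?(ltW (margY_gt0 _))// pow2_ge0.
have bad0 x y : (0 <= if dec (enc x) y != x then (p x y)%:E else 0)%E.
  by case: ifP => // _; rewrite lee_fin.
apply: (@le_trans _ _ (error + \esum_(x in [set: A]) \esum_(y in [set: B]) good x y)%E).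
  rewrite errorE -esumD; last 2 first.
  - by move=> x _; exact: esum_ge0.
  - by move=> x _; exact: esum_ge0.
  apply: le_esumT => x; rewrite -esumD//; apply: le_esumT => y.
  case: ifPn => [li|_]; last by rewrite adde_ge0.
  rewrite /good; case: eqVneq => /= _; last by rewrite adde0.
  rewrite add0e lee_fin joint_condX// ler_wpM2l ?(ltW (margY_gt0 _))//.
  rewrite -pow2N_nat -pow2D -opprD addrC.
  by apply: condX_le => //; rewrite addr_ge0.
apply: leeD2l; rewrite esum_swap// -[leRHS]mule1 -(sum_margY p_ge0 p_sum1).
rewrite -esumZl ?pow2_ge0// => [|y]; last by rewrite lee_fin ltW.
apply: le_esumT => y.
have -> : (\esum_(x in [set: A]) good x y = (margY p y * pow2 (- t))%:E *
    \esum_(x in [set x | dec (enc x) y == x]) ((2^-1 : R) ^+ size (enc x))%:E)%E.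
  rewrite esum_cond -esumZl; last 2 first.
  - by rewrite mulr_ge0 ?pow2_ge0// ltW.
  - by move=> x; case: ifP => // _; rewrite lee_fin.
  apply: eq_esum => x _; rewrite /good; case: ifP => _; last by rewrite mule0.
  by rewrite -EFinM mulrA.
rewrite -EFinM mulrC -[leRHS]mule1; apply: lee_wpmul2l.
  by rewrite lee_fin mulr_ge0 ?pow2_ge0// ltW.
apply: kraft => x x' /eqP Dx /eqP Dx' /enc_prefix exx'.
by rewrite -Dx -Dx' exx'.
Qed.

(** Averages [quantile_le] over [x] with [b x] equal to the code length plus [t]. The excess is
    truncated at [U]: below [U] it costs [U] times the probability from [long_info_prob], above [U]
    it goes to the tail that uniform integrability controls. *)
Lemma converse_oneshot (t U eps : R) : 0 < t -> 0 <= U -> 0 < eps ->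
  (\esum_(x in [set: A]) ((margX x)%:E * quantile eps x) <=
   \esum_(x in [set: A]) (margX x * (size (enc x))%:R)%:E + t%:E +
   (eps^-1)%:E * (U%:E * (error + (pow2 (- t))%:E) +
     \esum_(x in [set: A]) \esum_(y in [set: B])
       if (U <= info x y)%R then (p x y * info x y)%:E else 0))%E.
Proof.
move=> t0 U0 eps0; pose b x : R := (size (enc x))%:R + t.
have b0 x : 0 < b x by rewrite ltr_wpDl.
have i0 x y : 0 <= info x y by exact: info_ge0.
have e0 : 0 <= eps^-1 by rewrite invr_ge0 ltW.
have pi0 x y : (0 <= (p x y * info x y)%:E)%E by rewrite lee_fin mulr_ge0.
have if0 (c : bool) (z : \bar R) : (0 <= z -> 0 <= if c then z else 0)%E by case: c.
pose M x := (\esum_(y in [set: B]) if (b x < info x y)%R then (p x y * info x y)%:E else 0)%E.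
have M0 x : (0 <= M x)%E by apply: esum_ge0 => y _; exact: if0.
apply: (@le_trans _ _ (\esum_(x in [set: A])
   ((margX x * (size (enc x))%:R)%:E + (t%:E * (margX x)%:E + (eps^-1)%:E * M x)))%E).
  apply: le_esumT => x.
  apply: le_trans (_ : (margX x)%:E * _ <= _)%E _.
    by apply: lee_wpmul2l (quantile_le x (b0 x) eps0); rewrite lee_fin ltW.
  rewrite muleDr ?fin_num_adde_defr// -EFinM /b mulrDr EFinD -addeA.
  rewrite leeD2l// -EFinM (mulrC t) leeD2l//.
  rewrite muleCA lee_wpmul2l// ?lee_fin//.
  rewrite -esumZl ?(ltW (margX_gt0 _))//; last first.
    by move=> y; apply: if0; rewrite lee_fin mulr_ge0// condY_ge0.
  apply: le_esumT => y; case: ifP => _; last by rewrite mule0.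
  by rewrite -EFinM mulrA -joint_condY.
have m0 x : (0 <= (margX x)%:E)%E by rewrite lee_fin ltW.
rewrite esumD; last 2 first.
- by move=> x _; rewrite lee_fin mulr_ge0// ltW.
- by move=> x _; rewrite adde_ge0// mule_ge0// lee_fin// ltW.
rewrite esumD; last 2 first.
- by move=> x _; rewrite mule_ge0// lee_fin ltW.
- by move=> x _; rewrite mule_ge0// lee_fin.
rewrite esumZl ?(ltW t0)// sum_margX// mule1 addeA leeD2l// esumZl// lee_wpmul2l ?lee_fin//.
apply: le_trans (leeD (lee_wpmul2l _ (long_info_prob (ltW t0))) (lexx _)); last first.
  by rewrite lee_fin.
rewrite -esumZl// => [|x]; last by apply: esum_ge0 => y _; apply: if0; rewrite lee_fin.
rewrite -esumD; last 2 first.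
- move=> x _; rewrite mule_ge0 ?lee_fin//; apply: esum_ge0 => y _; apply: if0.
  by rewrite lee_fin.
- by move=> x _; apply: esum_ge0 => y _; exact: if0.
apply: le_esumT => x; rewrite -esumZl//; last by move=> y; apply: if0; rewrite lee_fin.
rewrite -esumD; last 2 first.
- by move=> y _; rewrite mule_ge0 ?lee_fin//; apply: if0; rewrite lee_fin.
- by move=> y _; exact: if0.
apply: le_esumT => y; rewrite -/(b x).
case: (ltP (b x)) => bi; last by rewrite mule0 add0e if0.
have [Ui|Ui] := leP U (info x y); first by rewrite leeDr// mule_ge0 ?lee_fin.
by rewrite adde0 -EFinM lee_fin mulrC ler_wpM2r// ltW.
Qed.

End Converse.

(** * Tools for greedy binning *)

(** Course-of-values recursion along [pickle]: [Q f x] sees [f] only at earlier points, so values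
    can be chosen one after another. *)
Lemma recursive_choice (A : countType) (S : Type) (s0 : S)
    (Q : (A -> S) -> A -> S -> Prop) :
  (forall f x, exists s, Q f x s) ->
  (forall f g x s, (forall x', (pickle x' < pickle x)%N -> f x' = g x') ->
    Q f x s -> Q g x s) ->
  exists f, forall x, Q f x (f x).
Proof.
move=> Qex Qext; pose c f x := sval (cid (Qex f x)).
have Qc f x : Q f x (c f x) by exact: svalP (cid (Qex f x)).
(* Stage [m] has settled the points with [pickle z < m] and holds the default [s0] elsewhere; by
   [gS] settled values never change. *)
pose g := fix g m : A -> S := if m is m'.+1 then
  fun z => if pickle z == m' then c (g m') z else g m' z else fun=> s0.
have gS z m : (pickle z < m)%N -> g m z = g (pickle z).+1 z.
  elim: m => // m IH; rewrite ltnS leq_eqVlt => /orP[/eqP<-//|zm].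
  by rewrite [LHS]/= ltn_eqF// IH.
exists (fun z => g (pickle z).+1 z) => x.
apply: (Qext (g (pickle x))) => [x' /gS//|].
by rewrite /= eqxx.
Qed.

(** The first [true] ends the unary header, so the header can be read off any extension. *)
Lemma prefix_unary (j j' : nat) (s s' : seq bool) :
  prefix (nseq j false ++ true :: s) (nseq j' false ++ true :: s') ->
  j = j' /\ prefix s s'.
Proof.
elim: j j' => [|j IH] [|j']//=.
by move=> /IH[-> ].
Qed.

(** A minimiser of [F] lies below the average; [s0] witnesses that [T] is nonempty. *)
Lemma exists_le_average {R : realType} (T : finType) (s0 : T) (F : T -> \bar R) (c : R) :
  (forall s, 0 <= F s)%E -> (\esum_(s in [set: T]) F s <= (c * #|T|%:R)%:E)%E ->
  exists s, (F s <= c%:E)%E.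
Proof.
move=> F0 FS; pose s1 := Order.arg_min s0 xpredT F.
have s1min s : (F s1 <= F s)%E.
  by rewrite /s1; case: Order.TotalTheory.arg_minP => // i _; exact.
have T0 : (0 < #|T|)%N by apply/card_gt0P; exists s0.
exists s1; have := le_trans (le_term_esum s1 F0) FS.
case E: (F s1) (F0 s1) => [w| |] // w0 _.
rewrite -(@lee_pmul2r _ #|T|%:R%:E) ?lte_fin ?ltr0n// -!EFinM.
apply: le_trans FS; apply: le_trans (_ : \esum_(s in [set: T]) w%:E <= _)%E; last first.
  by apply: le_esumT => s; rewrite -E.
have -> : [set: T] = [set` enum T].
  by apply/seteqP; split => // x _ /=; rewrite mem_enum.
rewrite esum_fset//.
by rewrite -fsbig_seq ?enum_uniq//= big_enum /= sumEFin sumr_const mulr_natr.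
Qed.

(** * One-shot achievability by greedy binning *)

Section Achievability.
Context {R : realType} {A B : countType} (p : A -> B -> R).
Hypothesis p_ge0 : forall x y, 0 <= p x y.
Hypothesis p_sum1 : (\esum_(z in [set: A * B]) (p z.1 z.2)%:E = 1)%E.
Hypothesis margX_gt0 : forall x, 0 < margX p x.
Hypothesis margY_gt0 : forall y, 0 < margY p y.

Local Notation info := (info p).
Local Notation condY := (condY p).
Local Notation condX := (condX p).
Local Notation margX := (margX p).
Local Notation quantile := (quantile p).

Variables (a : A -> R) (j : A -> nat) (K : nat) (t eps : R).
Hypothesis eps_ge0 : 0 <= eps.
Hypothesis a_quantile : forall x,
  (\esum_(y in [set y | (a x < info x y)%R]) (condY y x)%:E <= eps%:E)%E.
Hypothesis a_le : forall x, a x + t <= (K * j x)%:R.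

(** Typicality is stated through [condX] rather than [info], so that pairs of probability zero,
    whose [info] is 0, are never typical and counting stays possible. *)
Let typ x y := pow2 (- a x) <= condX x y.

Let p0 x y : (0 <= (p x y)%:E)%E. Proof. by rewrite lee_fin. Qed.

Let if0 (c : bool) (z : \bar R) : (0 <= z -> 0 <= if c then z else 0)%E.
Proof. by case: c. Qed.

(** Each counted [x] has conditional probability at least [pow2 (t - K * m)] by [a_le], and these
    probabilities sum to at most 1. *)
Lemma typical_count y m :
  (\esum_(x in [set: A]) (if (j x == m) && typ x y then 1 else 0)
    <= (pow2 ((K * m)%:R - t))%:E :> \bar R)%E.
Proof.
rewrite -[leRHS]mule1 -[X in (_ <= _ * X)%E](sum_condX p_ge0 p_sum1 margY_gt0 y).
rewrite -esumZl ?pow2_ge0// => [|x]; last by rewrite lee_fin condX_ge0.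
apply: le_esumT => x; case: ifPn => [/andP[/eqP<- txy]|_]; last first.
  by rewrite -EFinM lee_fin mulr_ge0 ?pow2_ge0 ?condX_ge0.
rewrite -EFinM lee_fin; apply: le_trans (ler_wpM2l (pow2_ge0 _) txy).
rewrite -pow2D -[leLHS](expR0 R) -(mul0r (ln 2)) -/(pow2 0) ler_pow2.
by have := a_le x; lra.
Qed.

(** Only earlier competitors count: their labels are already fixed when [x] gets its own, and a
    decoder taking the first candidate is not misled by later ones. *)
Definition collides (f : A -> seq bool) x s y : bool :=
  `[< exists x', [/\ (pickle x' < pickle x)%N, j x' = j x, f x' = s & typ x' y] >].

(* A union bound over the earlier typical sequences, averaged over all strings
   of length K * j x, replaces random binning. *)
Lemma exists_bin (f : A -> seq bool) x : exists s, size s = (K * j x)%N /\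
  (\esum_(y in [set: B]) (if collides f x s y then (p x y)%:E else 0)
    <= (margX x * pow2 (- t))%:E)%E.
Proof.
set N := (K * j x)%N.
pose F (s : N.-tuple bool) : \bar R :=
  (\esum_(y in [set: B]) if collides f x s y then (p x y)%:E else 0)%E.
suff [s Fs] : exists s, (F s <= (margX x * pow2 (- t))%:E)%E.
  by exists s; rewrite size_tuple.
apply: (@exists_le_average _ _ [tuple of nseq N false]).
  by move=> s; apply: esum_ge0 => y _; exact: if0.
pose c x' y := (j x' == j x) && typ x' y.
pose G (s : N.-tuple bool) y x' : \bar R :=
  (if c x' y && (f x' == s) then 1 else 0)%E.
have G0 s y x' : (0 <= G s y x')%E by exact: if0.
have GS0 s y : (0 <= \esum_(x' in [set: A]) G s y x')%E by exact: esum_ge0.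
(* Union bound: a collision is charged to every typical [x'] with header [j x] and label [s], the
   order condition being dropped. *)
apply: (@le_trans _ _ (\esum_(s in [set: N.-tuple bool]) \esum_(y in [set: B])
    ((p x y)%:E * \esum_(x' in [set: A]) G s y x')))%E.
  apply: le_esumT => s; apply: le_esumT => y; case: ifPn => [|_]; last exact: mule_ge0.
  move=> /asboolP[x' [_ jx' fx' tx']]; rewrite -[leLHS]mule1 lee_wpmul2l//.
  by apply: le_trans (le_term_esum x' _) => //; rewrite /G /c jx' fx' tx' !eqxx.
rewrite esum_swap; last by move=> s y; exact: mule_ge0.
rewrite card_tuple card_bool natrX -pow2_nat -mulrA -pow2D mulrC EFinM margXE//.
rewrite -esumZl ?pow2_ge0//; apply: le_esumT => y.
rewrite esumZl// muleC lee_wpmul2r// esum_swap//.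
rewrite addrC; apply: le_trans (typical_count y (j x)); apply: le_esumT => x'.
rewrite -/(c x' y) /G; case: (c x' y) => /=; last by rewrite esum1.
(* Each [x'] carries a single label, so it is counted for at most one [s]. *)
rewrite -(esum_cond (fun s : N.-tuple bool => f x' == s) (fun=> 1%E)).
by apply: esum_unique => // s s' /eqP -> /eqP /val_inj.
Qed.

(** An error means that [info] exceeds the threshold, of probability at most [eps], or that a
    collision occurs, of probability at most [pow2 (- t)]. The length is made of [j x] header bits,
    the terminator and [K * j x] label bits. *)
Lemma achievability_oneshot : exists (enc : A -> seq bool) (dec : seq bool -> B -> A),
  [/\ forall x x', prefix (enc x) (enc x') -> enc x = enc x',
      (error p enc dec <= (eps + pow2 (- t))%:E)%E &
      forall x, size (enc x) = (K.+1 * j x).+1].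
Proof.
have [f fP] : exists f, forall x, size (f x) = (K * j x)%N /\
  (\esum_(y in [set: B]) (if collides f x (f x) y then (p x y)%:E else 0)
    <= (margX x * pow2 (- t))%:E)%E.
  apply: (@recursive_choice A (seq bool) [::] (fun f x s => size s = (K * j x)%N /\
    (\esum_(y in [set: B]) (if collides f x s y then (p x y)%:E else 0)
      <= (margX x * pow2 (- t))%:E)%E)); first exact: exists_bin.
  move=> f g x s fg [-> fs]; split=> //; apply: le_trans fs.
  apply: le_esumT => y; case: ifPn => [/asboolP[x' [xx' jx fx tx]]|_]; last exact: if0.
  rewrite ifT//; apply/asboolP; exists x'; split=> //.
  by rewrite fg.
(* Total mass 1 makes [A] inhabited; [x0] is what the decoder returns when no candidate exists. *)
have [x0 _] : exists x0 : A, True.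
  apply: contrapT => nA; have := p_sum1.
  rewrite esum1; first by move=> [] /eqP; rewrite eq_sym oner_eq0.
  by move=> [x y]; case: nA; exists x.
pose enc x := nseq (j x) false ++ true :: f x.
(* Equal headers force labels of equal length, so a prefix relation between labels is an
   equality. *)
have encP x x' : prefix (enc x) (enc x') -> j x = j x' /\ f x = f x'.
  move=> /prefix_unary[jj]; rewrite prefixE => /eqP <-; split => //.
  by rewrite (fP x).1 jj -(fP x').1 take_size.
pose first s y := [set x | [/\ enc x = s, typ x y &
  forall x', (pickle x' < pickle x)%N -> ~ (enc x' = s /\ typ x' y)]].
exists enc, (fun s y => xget x0 (first s y)); split.
- by move=> x x' /encP[]; rewrite /enc => -> ->.
- rewrite errorE//.
  apply: (@le_trans _ _ (\esum_(x in [set: A])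
    (((margX x)%:E * eps%:E) + (margX x * pow2 (- t))%:E)))%E.
    apply: le_esumT => x; apply: le_trans (leeD (lee_wpmul2l _ (a_quantile x)) (fP x).2).
      rewrite esum_cond -esumZl ?(ltW (margX_gt0 _))//; last first.
        by move=> y; apply: if0; rewrite lee_fin condY_ge0.
      rewrite -esumD; last 2 first.
      - move=> y _; rewrite mule_ge0//; first by rewrite lee_fin ltW.
        by apply: if0; rewrite lee_fin condY_ge0.
      - by move=> y _; exact: if0.
      apply: le_esumT => y; case: ifPn => [dx|_]; last first.
        rewrite adde_ge0//; last exact: if0.
        rewrite mule_ge0//; first by rewrite lee_fin ltW.
        by apply: if0; rewrite lee_fin condY_ge0.
      case: ifPn => [ai|]; first by rewrite -EFinM -joint_condY// leeDl// if0.
      rewrite -leNgt => ia; rewrite mule0 add0e.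
      (* Pairs of probability zero are set aside first, since a small [info] makes only pairs of
         positive probability typical. *)
      have := p_ge0 x y; rewrite le_eqVlt => /orP[/eqP <-|pxy]; first by case: ifP.
      rewrite ifT//; apply/asboolP; apply: contrapT => nc.
      move/negP: dx; apply; apply/eqP.
      have Fx : first (enc x) y x.
        split=> //; first exact: condX_ge.
        move=> x' xx' [ex' tx']; apply: nc; exists x'.
        by have [|-> ->] := encP x' x; first by rewrite ex' prefix_refl.
      apply: xget_unique => // z [ez tz Fz]; apply: (pcan_inj pickleK).
      apply/eqP; rewrite eqn_leq; apply/andP; split; rewrite leqNgt; apply/negP.
        by case: Fx => ex tx _ /Fz; apply.
      by case: Fx => _ _ H /H; apply.
    by rewrite lee_fin ltW.
  rewrite esumD; last 2 first.
  - by move=> x _; rewrite mule_ge0// ?lee_fin// ltW.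
  - by move=> x _; rewrite lee_fin mulr_ge0 ?pow2_ge0// ltW.
  rewrite EFinD; apply: leeD.
    under eq_esum do rewrite muleC.
    by rewrite esumZl// ?sum_margX ?mule1// => x; rewrite lee_fin ltW.
  under eq_esum do rewrite mulrC EFinM.
  by rewrite esumZl ?pow2_ge0// ?sum_margX ?mule1// => x; rewrite lee_fin ltW.
- by move=> x; rewrite size_cat size_nseq /= (fP x).1 addnS mulSn.
Qed.

End Achievability.

(** * Expected length in terms of the quantile *)

Section ExpectedLength.
Context {R : realType} {A B : countType} (p : A -> B -> R).
Hypothesis p_ge0 : forall x y, 0 <= p x y.
Hypothesis p_sum1 : (\esum_(z in [set: A * B]) (p z.1 z.2)%:E = 1)%E.
Hypothesis margX_gt0 : forall x, 0 < margX p x.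
Hypothesis margY_gt0 : forall y, 0 < margY p y.

(** A negative threshold is exceeded for every [y], hence with probability 1, which is more than
    [eps]. *)
Lemma quantile_set_ge0 (eps a : R) x : eps < 1 ->
  (\esum_(y in [set y | (a < info p x y)%R]) (condY p y x)%:E <= eps%:E)%E -> 0 <= a.
Proof.
move=> eps1; apply: contraTT; rewrite -ltNge -ltNge => a0.
rewrite (_ : [set y | _] = setT); first by rewrite sum_condY// lte_fin.
by apply/seteqP; split=> // y _; exact: lt_le_trans (info_ge0 _ _ _ _ _).
Qed.

Lemma quantile_ge0 (eps : R) x : eps < 1 -> (0 <= quantile p eps x)%E.
Proof.
by move=> e1; apply: le_ereal_inf_tmp => _ [a /= /(quantile_set_ge0 e1) a0 <-]; rewrite lee_fin.
Qed.

(** Thresholds within 1 of the quantile, rounded up to multiples of [K], cost at most [1 + K] extra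
    label bits; the unary header adds the factor [1 + K%:R^-1] and its terminator the last 1.
    Finiteness of [H] makes every quantile finite. *)
Lemma achievability_quantile (eps t : R) (K : nat) :
  let H := (\esum_(x in [set: A]) ((margX p x)%:E * quantile p eps x))%E in
  0 <= eps < 1 -> 0 <= t -> (0 < K)%N -> (H < +oo)%E ->
  exists (enc : A -> seq bool) (dec : seq bool -> B -> A),
  [/\ forall x x', prefix (enc x) (enc x') -> enc x = enc x',
      (error p enc dec <= (eps + pow2 (- t))%:E)%E &
      (\esum_(x in [set: A]) (margX p x * (size (enc x))%:R)%:E <=
        (1 + K%:R^-1)%:E * (H + (1 + t + K%:R)%:E) + 1)%E].
Proof.
move=> H /andP[eps0 eps1] t0 K0 Hoo.
have K0' : 0 < K%:R :> R by rewrite ltr0n.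
have q0 x : (0 <= quantile p eps x)%E by exact: quantile_ge0.
have mq0 x : (0 <= (margX p x)%:E * quantile p eps x)%E.
  by rewrite mule_ge0// lee_fin ltW.
have qfin x : quantile p eps x \is a fin_num.
  rewrite ge0_fin_numE//; have := le_lt_trans (le_term_esum x mq0) Hoo.
  case: (quantile p eps x) (q0 x) => [r| |]//= _; first by move=> _; rewrite ltry.
  by rewrite gt0_muley ?lte_fin.
have aE x : exists a : R,
    (\esum_(y in [set y | (a < info p x y)%R]) (condY p y x)%:E <= eps%:E)%E /\
    a < fine (quantile p eps x) + 1.
  have : (quantile p eps x < quantile p eps x + 1)%E by rewrite lteDl.
  move=> /ereal_inf_lt[_ [a /= aq <-] alt]; exists a; split => //.
  by move: alt; rewrite -lte_fin EFinD fineK.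
have {aE}[a aP] := choice aE.
have a0 x : 0 <= a x by exact: quantile_set_ge0 (aP x).1.
pose j x := (Num.truncn ((a x + t) / K%:R)).+1.
have jP x : a x + t <= (K * j x)%:R <= a x + t + K%:R.
  have /truncn_itv/andP[j1 j2] : 0 <= (a x + t) / K%:R.
    by rewrite divr_ge0 ?addr_ge0// ltW.
  rewrite natrM mulrC; apply/andP; split; first by rewrite -ler_pdivrMr// ltW.
  by rewrite -[X in _ <= _ + X]mul1r -lerBlDr -mulrBl -ler_pdivlMr// /j -natr1 addrK.
have [||enc [dec [encP errP sizeP]]] := @achievability_oneshot _ _ _ p p_ge0 p_sum1
  margX_gt0 margY_gt0 a j K t eps eps0.
- by move=> x; have [] := aP x.
- by move=> x; have /andP[] := jP x.
exists enc, dec; split=> //.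
pose c : R := 1 + K%:R^-1.
have c0 : 0 <= c by rewrite addr_ge0// invr_ge0 ltW.
apply: (@le_trans _ _ (\esum_(x in [set: A]) (c%:E * ((margX p x)%:E * quantile p eps x) +
   (c * (1 + t + K%:R) + 1)%:E * (margX p x)%:E)))%E.
  apply: le_esumT => x; rewrite -(fineK (qfin x)) -!EFinM -EFinD lee_fin.
  rewrite sizeP -natr1 [leLHS]mulrC.
  have [/andP[_ j2] [_ a1]] := (jP x, aP x).
  have -> : (K.+1 * j x)%:R = c * (K * j x)%:R :> R.
    by rewrite !natrM -natr1 /c; field; rewrite gt_eqF.
  have m0 := margX_gt0 x; set m := margX p x in m0 *; set q := fine _ in a1 *.
  rewrite (_ : c * (m * q) + _ = (c * (q + 1 + t + K%:R) + 1) * m); last by ring.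
  by apply: ler_wpM2r; rewrite ?(ltW m0)// lerD2r ler_wpM2l//; lra.
have c1 : 0 <= c * (1 + t + K%:R) + 1 by rewrite addr_ge0// mulr_ge0// !addr_ge0// ltW.
rewrite esumD; last 2 first.
- by move=> x _; rewrite mule_ge0// lee_fin.
- by move=> x _; rewrite mule_ge0// lee_fin// ltW.
rewrite esumZl// esumZl//; last by move=> x; rewrite lee_fin ltW.
rewrite sum_margX// mule1 -/H -/c; clearbody c.
rewrite EFinD EFinM addeA muleDr// ge0_adde_def// inE ?lee_fin.
  by rewrite esum_ge0.
by rewrite !addr_ge0// ltW.
Qed.

Lemma le_quantile (eps eps' : R) x : eps <= eps' -> (quantile p eps' x <= quantile p eps x)%E.
Proof.
move=> ee; apply: ereal_inf_le_tmp => _ [a /= ha <-]; exists a => //.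
by apply: le_trans ha _; rewrite lee_fin.
Qed.

End ExpectedLength.

(** * Limits superior and eventual bounds *)

Section LimitSuperior.
Context {R : realType}.
Local Open Scope ereal_scope.
Implicit Types (u : (\bar R)^nat) (c : \bar R).

Lemma limn_esupE u : limn_esup u = ereal_inf (range (esups u)).
Proof. by rewrite limn_esup_lim; apply/cvg_lim => //; exact: cvg_esups_inf. Qed.

Lemma limn_esup_lt_near u c : limn_esup u < c -> \forall n \near \oo, u n < c.
Proof.
rewrite limn_esupE => /ereal_inf_lt[_ [m _ <-] mc]; exists m => // n /= mn.
by apply: le_lt_trans mc; apply: ereal_sup_ubound; exists n.
Qed.

Lemma near_limn_esup_le u c : (\forall n \near \oo, u n <= c) -> limn_esup u <= c.
Proof.
move=> [N _ uc]; rewrite limn_esupE; apply: ge_ereal_inf.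
exists (esups u N); first by exists N.
by apply: ge_ereal_sup => _ [n /= Nn <-]; exact: uc.
Qed.

Lemma near_pow2N_le (c e : R) : (0 < c)%R -> (0 < e)%R ->
  \forall n \near \oo, (pow2 (- (n%:R * c)) <= e)%R.
Proof.
move=> c0 e0; near=> n.
rewrite -(pow2_log2 e0) ler_pow2 lerNl -ler_pdivrMr//.
near: n; exact: nbhs_infty_ger.
Unshelve. all: by end_near. Qed.

(** Nonnegativity is given only for positive indices, hence the shift by one. *)
Lemma cvge0_near u : (forall n, (0 < n)%N -> 0 <= u n) ->
  (forall e : R, (0 < e)%R -> \forall n \near \oo, u n <= e%:E) ->
  u @ \oo --> 0.
Proof.
move=> u0 ue; suff : [sequence u n.+1]_n @ \oo --> 0 by rewrite cvg_shiftS.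
apply: limn_esup_le_cvg => [|n]; last exact: u0.
apply/lee_addgt0Pr => e e0; rewrite add0e; apply: near_limn_esup_le.
have [N _ H] := ue e e0; exists N => // n Nn; apply: H.
exact: leq_trans (leqnSn _).
Qed.

End LimitSuperior.

(** * From one blocklength to the general source *)

Section Source.
Context {R : realType} {X Y : countType} (P : source R X Y).
Hypothesis P_source : is_source P.

(** Exchanging sums turns the tail over values [z] into a sum over pairs, where each pair
    contributes through [z = Zn P x y] and [info] is [n] times this value. *)
Lemma UI_tail_ge n (u : R) : (0 < n)%N ->
  (\esum_(x in [set: n.-tuple X]) \esum_(y in [set: n.-tuple Y])
     (if (n%:R * u <= info (@P n) x y)%R then (P x y * info (@P n) x y)%:E else 0)
   <= n%:R%:E * UI_tail P n u)%E.
Proof.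
move=> n0; have [P0 P1 PX0 PY0] := P_source n0.
have n0' : 0 < n%:R :> R by rewrite ltr0n.
have i0 x y : 0 <= info (@P n) x y by exact: (info_ge0 P0 P1 PY0).
have Z0 (x : n.-tuple X) (y : n.-tuple Y) : 0 <= Zn P x y.
  by rewrite -[Zn P x y]/(n%:R^-1 * info (@P n) x y) mulr_ge0// invr_ge0 ler0n.
have nZ (x : n.-tuple X) (y : n.-tuple Y) : info (@P n) x y = n%:R * Zn P x y.
  by rewrite -[Zn P x y]/(n%:R^-1 * info (@P n) x y) mulrA divff ?gt_eqF// mul1r.
have if0 (c : bool) (z : \bar R) : (0 <= z -> 0 <= if c then z else 0)%E by case: c.
have PZE z : ((PZ P n z)%:E = \esum_(w in [set: n.-tuple X * n.-tuple Y])
    if Zn P w.1 w.2 == z then (P w.1 w.2)%:E else 0)%E.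
  have e : [set w | Zn P w.1 w.2 = z] = [set w : n.-tuple X * n.-tuple Y | Zn P w.1 w.2 == z].
    by apply/seteqP; split=> w /eqP.
  rewrite /PZ fineK ?e ?esum_cond// ge0_fin_numE; last first.
    by apply: esum_ge0 => w _; apply: if0; rewrite lee_fin.
  apply: le_lt_trans (ltry 1); rewrite -P1; apply: le_esumT => w.
  by case: ifP => // _; rewrite lee_fin.
pose G (z : R) (w : n.-tuple X * n.-tuple Y) : \bar R :=
  if Zn P w.1 w.2 == z then (`|z| * P w.1 w.2)%:E else 0%E.
have G0 z w : (0 <= G z w)%E by apply: if0; rewrite lee_fin mulr_ge0.
have UIE : (UI_tail P n u = \esum_(w in [set: n.-tuple X * n.-tuple Y])
    \esum_(z in [set: R]) if (u <= `|z|)%R then G z w else 0)%E.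
  rewrite -(esum_swap (f := fun z (w : n.-tuple X * n.-tuple Y) =>
    if (u <= `|z|)%R then G z w else 0%E)); last first.
    by move=> z w; exact: if0.
  rewrite /UI_tail esum_cond; apply: eq_esum => z _; case: ifP => _; last by rewrite esum1.
  rewrite mulrC EFinM PZE -esumZl//.
    by apply: eq_esum => w _; rewrite /G; case: ifP => _; rewrite ?mule0.
  by move=> w; apply: if0; rewrite lee_fin.
rewrite UIE -esumZl ?(ltW n0')//; last first.
  by move=> w; apply: esum_ge0 => z _; exact: if0.
rewrite -(esum_pair (f := fun (x : n.-tuple X) (y : n.-tuple Y) => if n%:R * u <= info (@P n) x y
  then (P x y * info (@P n) x y)%:E else 0%E)); last first.
  by move=> x y; apply: if0; rewrite lee_fin mulr_ge0//; exact: (info_ge0 P0 P1 PY0).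
apply: le_esumT => -[x y] /=.
rewrite -esumZl ?(ltW n0')//; last by move=> z; exact: if0.
set h := (X in (_ <= \esum_(z in _) X z)%E).
have h0 z : (0 <= h z)%E by rewrite /h mule_ge0 ?lee_fin ?(ltW n0')// if0.
apply: le_trans (le_term_esum (Zn P x y) h0); rewrite /h nZ ler_pM2l// ger0_norm//.
case: ifP => _; last by rewrite mule0.
by rewrite /G /= eqxx -EFinM lee_fin ger0_norm// mulrC -mulrA lexx.
Qed.

(** The one-shot notions repeat the source definitions at a fixed [n], so both sides are
    convertible. *)
Lemma Hs_epsE n (eps : R) : Hs_eps P n eps =
  (\esum_(x in [set: n.-tuple X]) ((margX (@P n) x)%:E * quantile (@P n) eps x))%E.
Proof. by []. Qed.

Let rate (eps : R) : \bar R := limn_esup (fun n => (n%:R^-1)%:E * Hs_eps P n eps)%E.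

Lemma le_rate (eps eps' : R) : eps <= eps' -> (rate eps' <= rate eps)%E.
Proof.
move=> ee; rewrite /rate !limn_esupE; apply: le_ereal_inf_tmp => _ [N _ <-].
(* The tail starts at [N.+1] to exclude [n = 0], where the source is unconstrained. *)
apply: ge_ereal_inf; exists (esups (fun n => (n%:R^-1)%:E * Hs_eps P n eps')%E N.+1).
  by exists N.+1.
apply: ge_ereal_sup => _ [n /= Nn <-].
apply: le_trans (_ : (n%:R^-1)%:E * Hs_eps P n eps <= _)%E; last first.
  by apply: ereal_sup_ubound; exists n => //; exact: ltnW.
have n0 : (0 < n)%N by exact: leq_trans Nn.
have [_ _ PX0 _] := P_source n0.
apply: lee_wpmul2l; first by rewrite lee_fin invr_ge0.
rewrite !Hs_epsE; apply: le_esumT => x; apply: lee_wpmul2l; last exact: le_quantile.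
by rewrite lee_fin ltW//; exact: PX0.
Qed.

(** [rate] is nonincreasing in [eps], so its right limit at 0 is a supremum. *)
Lemma Hs_barE : Hs_bar P = ereal_sup [set rate eps | eps in `]0, 1[].
Proof.
apply/cvg_lim => //; apply: (nonincreasing_at_right_cvge (BLeft 1)).
  by rewrite bnd_simp.
by move=> x y _ _; exact: le_rate.
Qed.

Lemma achievable_of_Hs_bar (r : R) : (Hs_bar P < r%:E)%E -> weakly_achievable P r.
Proof.
move=> Hr.
have [r' Hr' rr'] : exists2 r' : R, (Hs_bar P < r'%:E)%E & r' < r.
  case: (Hs_bar P) Hr => [h| |] // => [|_].
    rewrite lte_fin => hr; exists ((h + r) / 2); rewrite ?lte_fin; lra.
  by exists (r - 1); rewrite ?ltNyr//; lra.
(* With [k = K%:R^-1] and [t = n * k], the final rate exceeds [r'] by at most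
   [k * (r' + 3 + 2 * k)], which is below [k * (|r'| + 6)]. *)
have [K K0 Kr] : exists2 K : nat, (0 < K)%N & K%:R^-1 * (`|r'| + 6) <= r - r'.
  have rr0 : 0 < r - r' by rewrite subr_gt0.
  exists (Num.truncn ((`|r'| + 6) / (r - r'))).+1 => //.
  rewrite mulrC ler_pdivrMr ?ltr0n// mulrC -ler_pdivrMr//.
  have /truncn_itv/andP[_ /ltW//] : 0 <= (`|r'| + 6) / (r - r').
  by rewrite divr_ge0 ?(ltW rr0)// addr_ge0.
have K0' : 0 < K%:R :> R by rewrite ltr0n.
have [x0 _] : exists x : X, True.
  have [_ P1 _ _] := P_source (ltnSn 0).
  apply: contrapT => nX; move: P1.
  rewrite esum1; first by move=> [] /eqP; rewrite eq_sym oner_eq0.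
  by move=> [x y]; case: nX; exists (thead x).
(* Diagonal choice: [kk n] is the largest [k <= n] whose level [1 / (k + 2)] already has rate below
   [r']. It tends to infinity because every fixed [k] is eventually good; the offset 2 keeps the
   level below 1. *)
pose good n k := `[< ((n%:R^-1)%:E * Hs_eps P n k.+2%:R^-1 < r'%:E)%E >].
pose kk n := \max_(k < n.+1 | good n k) k.
have kkP k0 : \forall n \near \oo, (k0 <= kk n)%N /\ good n (kk n).
  near=> n.
  have gk0 : good n k0.
    apply/asboolP; near: n; apply: limn_esup_lt_near; apply: le_lt_trans Hr'.
    rewrite Hs_barE; apply: ereal_sup_ubound; exists k0.+2%:R^-1 => //=.
    by rewrite in_itv/= invr_gt0 ltr0n invf_lt1 ?ltr1n// ltr0n.
  have k0n : (k0 < n.+1)%N by rewrite ltnS; near: n; exact: nbhs_infty_ge.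
  split; first by apply: (leq_bigmax_cond (Ordinal k0n)).
  have [|i gi e] := @eq_bigmax_cond _ (fun i : 'I_n.+1 => good n i) (fun i => i : nat).
    by apply/card_gt0P; exists (Ordinal k0n).
  by have -> : kk n = i by exact: e.
pose eps n : R := (kk n).+2%:R^-1.
pose spec n (c : (n.-tuple X -> seq bool) * (seq bool -> n.-tuple Y -> n.-tuple X)) :=
  (0 < n)%N -> prefix_free c.1 /\ (good n (kk n) ->
    (err_prob P c.1 c.2 <= (eps n + pow2 (- (n%:R * K%:R^-1)))%:E)%E /\
    (exp_len P c.1 <= (1 + K%:R^-1)%:E *
      (Hs_eps P n (eps n) + (1 + n%:R * K%:R^-1 + K%:R)%:E) + 1)%E).
have codeP n : exists c, spec n c.
  have [->|n0] := posnP n; first by exists (fun=> [::], fun _ _ => nseq_tuple 0 x0).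
  (* At the remaining blocklengths a constant empty code suffices, as it is prefix-free in the sense
     of [prefix_free]. *)
  have [gn|gn] := boolP (good n (kk n)); last first.
    by exists (fun=> [::], fun _ _ => nseq_tuple n x0) => _; split=> [x x'//|/(negP gn)].
  have [P0 P1 PX0 PY0] := P_source n0.
  have [||||enc [dec [encP errP lenP]]] := @achievability_quantile _ _ _ (@P n) P0 P1 PX0 PY0
    (eps n) (n%:R * K%:R^-1) K.
  - by rewrite invr_ge0 ler0n invf_lt1 ?ltr1n// ltr0n.
  - by rewrite mulr_ge0 ?invr_ge0 ?ler0n.
  - by [].
  - move/asboolP: gn; rewrite muleC lte_pdivrMr ?ltr0n// => /lt_le_trans; apply.
    by rewrite -EFinM leey.
  by exists (enc, dec) => _; split.
pose code n := sval (cid (codeP n)).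
have cP n : spec n (code n) by exact: svalP (cid (codeP n)).
exists (fun n => (code n).1), (fun n => (code n).2); split.
- by move=> n /cP[].
- apply: cvge0_near => [n n0|e e0].
    have [P0 _ _ _] := P_source n0.
    by apply: esum_ge0 => w _; rewrite lee_fin.
  near=> n.
  have n0 : (0 < n)%N by near: n; exact: nbhs_infty_gt.
  pose k0 := Num.truncn (2 / e).
  have [kn gn] : (k0 <= kk n)%N /\ good n (kk n) by near: n; exact: kkP.
  have [+ _] := (cP n n0).2 gn.
  move=> /le_trans; apply; rewrite lee_fin (splitr e); apply: lerD.
    have k0e : 2 / e < k0.+1%:R by rewrite Num.Theory.truncnS_gt.
    rewrite -[leRHS]invrK lef_pV2 ?posrE ?ltr0n ?invr_gt0 ?divr_gt0//.
    rewrite invf_div (le_trans (ltW k0e))// ler_nat.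
    by rewrite ltnS leqW.
  near: n; apply: near_pow2N_le; last by rewrite divr_gt0.
  by rewrite invr_gt0.
- apply: near_limn_esup_le; near=> n.
  have n0 : (0 < n)%N by near: n; exact: nbhs_infty_gt.
  have n0' : 0 < n%:R :> R by rewrite ltr0n.
  have [_ gn] : (0 <= kk n)%N /\ good n (kk n) by near: n; exact: kkP.
  have [_ lenP] := (cP n n0).2 gn.
  rewrite muleC lee_pdivrMr//; apply: le_trans lenP _.
  move/asboolP: gn; rewrite muleC lte_pdivrMr// -EFinM => /ltW Hs.
  (* For such [n] the additive constant [1 + K] is absorbed into [n * k]. *)
  have nK : (1 + K%:R) * K%:R <= n%:R :> R by near: n; exact: nbhs_infty_ger.
  set k : R := K%:R^-1 in Kr *.
  have k0 : 0 < k by rewrite invr_gt0.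
  have k1 : k <= 1 by rewrite invf_le1// ler1n.
  have kn : 1 + K%:R <= n%:R * k by rewrite -ler_pdivrMr ?invr_gt0// invrK.
  apply: (@le_trans _ _ ((1 + k)%:E * ((r' * n%:R)%:E + (1 + n%:R * k + K%:R)%:E) + 1)%E).
    apply: leeD2r; apply: lee_wpmul2l; first by rewrite lee_fin addr_ge0// ltW.
    exact: leeD2r.
  rewrite -!(EFinD, EFinM) lee_fin.
  apply: (@le_trans _ _ ((1 + k) * (r' * n%:R + n%:R * k + n%:R * k) + n%:R * k)).
    apply: lerD; first by rewrite ler_wpM2l ?addr_ge0 ?(ltW k0)//; lra.
    by apply: le_trans kn; rewrite lerDl.
  rewrite (_ : _ + _ = ((1 + k) * (r' + k + k) + k) * n%:R); last by ring.
  rewrite ler_wpM2r//.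
  have rk : k * r' <= k * `|r'| by rewrite ler_wpM2l ?ler_norm// ltW.
  have kk1 : k * k <= k * 1 by rewrite ler_wpM2l// ltW.
  rewrite !mulrDr !mulrDl !mul1r in Kr *; lra.
Unshelve. all: by end_near. Qed.

Hypothesis P_UI : uniformly_integrable P.

Lemma converse_rate (r eps : R) : weakly_achievable P r -> 0 < eps -> (rate eps <= r%:E)%E.
Proof.
move=> [enc [dec [encP err0 lenr]]] eps0; apply/lee_addgt0Pr => e e0.
(* Four terms each cost [d] per symbol: the length, [t = n * d], the truncated part and the tail. *)
pose d := e / 4; have d0 : 0 < d by rewrite divr_gt0.
have [u [u0 uP]] : exists u : R, 0 < u /\ forall n, (0 < n)%N -> (UI_tail P n u <= (eps * d)%:E)%E.
  have ed0 : (0 < (eps * d)%:E)%E by rewrite lte_fin mulr_gt0.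
  have : \forall u \near +oo, (
    ereal_sup [set UI_tail P n u | n in [set n | (0 < n)%N]] < (eps * d)%:E)%E.
    exact: (P_UI (open_ereal_lt' ed0)).
  move=> H; have [u [up uH]] := filter_ex (filterI (nbhs_pinfty_gt (num_real (0:R))) H).
  exists u; split=> // n n0; apply/ltW; apply: le_lt_trans uH.
  by apply: ereal_sup_ubound; exists n.
(* The error and [pow2 (- t)] will each be at most [delta], so that
   [eps^-1 * u * (delta + delta) = d]. *)
pose delta := eps * d / (2 * u).
have delta0 : 0 < delta by rewrite divr_gt0 ?mulr_gt0.
apply: near_limn_esup_le.
have lenr' : (limn_esup (fun n => (n%:R^-1)%:E * exp_len P (enc n)) < (r + d)%:E)%E.
  by apply: le_lt_trans lenr _; rewrite lte_fin ltrDl.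
have Herr : \forall n \near \oo, (err_prob P (enc n) (dec n) < delta%:E)%E.
  have d0E : (0 < delta%:E)%E by rewrite lte_fin.
  exact: (err0 _ (open_ereal_lt' d0E)).
near=> n.
have n0 : (0 < n)%N by near: n; exact: nbhs_infty_gt.
have n0' : 0 < n%:R :> R by rewrite ltr0n.
have [P0 P1 PX0 PY0] := P_source n0.
have := @converse_oneshot _ _ _ (@P n) P0 P1 PX0 PY0 (enc n) (dec n) (encP n n0)
  (n%:R * d) (n%:R * u) eps (mulr_gt0 n0' d0) (ltW (mulr_gt0 n0' u0)) eps0.
rewrite -Hs_epsE => Hconv.
have Hlen : (exp_len P (enc n) <= (n%:R * (r + d))%:E)%E.
  rewrite EFinM muleC -lee_pdivrMr// muleC; apply: ltW; near: n.
  exact: limn_esup_lt_near lenr'.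
have Hpow : pow2 (- (n%:R * d)) <= delta by near: n; exact: near_pow2N_le.
have Hn : (err_prob P (enc n) (dec n) < delta%:E)%E by near: n.
rewrite muleC lee_pdivrMr// -EFinM; apply: le_trans Hconv _.
have Htail : (\esum_(x in [set: n.-tuple X]) \esum_(y in [set: n.-tuple Y])
     (if (n%:R * u <= info (@P n) x y)%R then (P x y * info (@P n) x y)%:E else 0)
   <= (n%:R * (eps * d))%:E)%E.
  apply: le_trans (UI_tail_ge _ n0) _; rewrite EFinM; apply: lee_wpmul2l.
    by rewrite lee_fin ltW.
  exact: uP.
apply: (@le_trans _ _ ((n%:R * (r + d))%:E + (n%:R * d)%:E + (eps^-1)%:E *
   ((n%:R * u)%:E * (delta%:E + delta%:E) + (n%:R * (eps * d))%:E))%E).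
  apply: leeD; first exact: leeD2r.
  apply: lee_wpmul2l; first by rewrite lee_fin invr_ge0 ltW.
  apply: leeD => //; apply: lee_wpmul2l; first by rewrite lee_fin mulr_ge0// ltW.
  by apply: leeD; rewrite ?lee_fin//; exact: ltW.
rewrite -!(EFinM, EFinD) lee_fin le_eqVlt; apply/orP; left; apply/eqP.
by rewrite /delta /d; field; rewrite !gt_eqF.
Unshelve. all: by end_near. Qed.

End Source.

Theorem theorem7 (R : realType) (X Y : countType) (P : source R X Y) :
  is_source P -> uniformly_integrable P -> R_SW P = Hs_bar P.
Proof.
move=> Psrc PUI; apply/eqP; rewrite eq_le; apply/andP; split; last first.
  apply: le_ereal_inf_tmp => _ [r rach <-]; rewrite Hs_barE//.
  apply: ge_ereal_sup => _ [eps /= + <-]; rewrite in_itv/= => /andP[eps0 _].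
  exact: converse_rate.
have H (r : R) : (Hs_bar P < r%:E)%E -> (R_SW P <= r%:E)%E.
  by move=> /(achievable_of_Hs_bar Psrc) ra; apply: ereal_inf_lbound; exists r.
case: (Hs_bar P) H => [h| |] H; last 2 first.
- by rewrite leey.
(* When [Hs_bar P] is minus infinity, [R_SW P] lies below every real, so it is minus infinity
   too. *)
- case: (R_SW P) H => [s| |] // H.
    by have := H (s - 1)%R (ltNyr _); rewrite lee_fin lerBrDr gerDl ler10.
  by have := H 0%R (ltNyr _); rewrite leye_eq.
by apply/lee_addgt0Pr => e e0; rewrite -EFinD H// lte_fin ltrDl.
Qed.
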